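(* Let $\mathbb{G}=(\mathbb{N},\mathbb{E})$, $\mathbb{N}=\{1,\dots,N\}$, be an undirected connected graph with neighbour sets $\mathbb{N}_i=\{j : \{i,j\}\in\mathbb{E}\}$. Let $f:\mathbb{R}\to\mathbb{R}$ be strictly increasing, odd and bounded, and let $h:\mathbb{R}\to\mathbb{R}$ be strictly increasing. Let $\{n_{ij}(t)\}$ (indexed by $t\in\{0,1,2,\dots\}$ and ordered pairs $(i,j)$ with $\{i,j\}\in\mathbb{E}$) be mutually independent, identically distributed real random variables whose common distribution is symmetric about zero. Let $\alpha(t)>0$ satisfy $\sum_{t\ge 0}\alpha(t)=\infty$ and $\sum_{t\ge 0}\alpha^2(t)<\infty$. Let $\mathbf{X}(t)=[x_1(t),\dots,x_N(t)]^{\mathrm T}$ be the process with initial state $\mathbf{X}(0)\in\mathbb{R}^N$ and $$x_i(t+1)=x_i(t)-\alpha(t)\sum_{j\in\mathbb{N}_i} f\bigl(h(x_i(t))-h(x_j(t))-n_{ij}(t)\bigr),\qquad i=1,\dots,N,\ t\ge 0.$$ Then $\mathbf{X}(t)$ approaches the consensus subspace $\mathbb{B}=\{a\mathbf{1} : a\in\mathbb{R}\}\subset\mathbb{R}^N$ almost surely, i.e. $$\Pr\Bigl[\lim_{t\to\infty}\ \inf_{\mathbf{z}\in\mathbb{B}}\|\mathbf{X}(t)-\mathbf{z}\|=0\Bigr]=1 .$$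
   Context: $\mathbf{1}=[1,\dots,1]^{\mathrm T}\in\mathbb{R}^N$ and $\|\cdot\|$ is the Euclidean norm. The graph is simple. The initial state $\mathbf{X}(0)$ is a fixed (deterministic) vector. No moment assumptions are made on the noise $n_{ij}(t)$. *)

(* Defs.v *)
(* MathComp / MathComp-Analysis *)
From HB Require Import structures.
From mathcomp Require Import all_boot all_order all_algebra.
From mathcomp Require Import all_classical all_reals all_analysis.

Set Implicit Arguments.
Unset Strict Implicit.
Unset Printing Implicit Defensive.

Import Order.TTheory GRing.Theory Num.Theory.
Import numFieldNormedType.Exports.

Local Open Scope classical_set_scope.
Local Open Scope ring_scope.

(* Mutual independence of the subfamily (X k)_{k in K}: the product rule over
   every finite set of distinct indices of K, enumerated by the sequence s.
   Indices outside K are unconstrained. *)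
Definition mutually_independent (R : realType) (d : measure_display)
    (T : measurableType d) (P : probability T R)
    (I : eqType) (K : set I) (X : I -> {RV P >-> R}) : Prop :=
  forall (s : seq I) (B : I -> set R),
    uniq s -> (forall k, k \in s -> K k) ->
    (forall k, measurable (B k)) ->
    P (\bigcap_(k in [set` s]) (X k @^-1` B k)) =
    (\prod_(k <- s) P (X k @^-1` B k))%E.

Definition identically_distributed (R : realType) (d : measure_display)
    (T : measurableType d) (P : probability T R)
    (I : Type) (K : set I) (X : I -> {RV P >-> R}) : Prop :=
  forall k l, K k -> K l -> forall B : set R, measurable B ->
    distribution P (X k) B = distribution P (X l) B.

Definition symmetric_about_zero (R : realType) (d : measure_display)
    (T : measurableType d) (P : probability T R) (X : {RV P >-> R}) : Prop :=
  forall B : set R, measurable B ->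
    distribution P X (-%R @` B) = distribution P X B.

(* The library norm `|x| on matrices is the sup norm, so the Euclidean norm is
   given explicitly. *)
Definition euclidean_norm (R : realType) (N : nat) (x : 'cV[R]_N) : R :=
  Num.sqrt (\sum_(i < N) x i 0 ^+ 2).

Definition consensus_subspace (R : realType) (N : nat) : set 'cV[R]_N :=
  [set z | exists a : R, z = a *: const_mx 1].

Definition euclidean_dist (R : realType) (N : nat)
    (x : 'cV[R]_N) (A : set 'cV[R]_N) : R :=
  inf [set euclidean_norm (x - z) | z in A].

(* Main.v *)
Require Import Defs.
From HB Require Import structures.
From mathcomp Require Import all_boot all_order all_algebra.
From mathcomp Require Import all_classical all_reals all_analysis.
From mathcomp Require Import measurable_realfun.
From mathcomp Require Import ring lra.

Import Order.TTheory GRing.Theory Num.Theory.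
Import numFieldNormedType.Exports.

Local Open Scope classical_set_scope.
Local Open Scope ring_scope.

Set Implicit Arguments.
Unset Strict Implicit.
Unset Printing Implicit Defensive.

(* The squared norm V = |X|^2 is a Lyapunov function. Writing F(y) = E f(y - n),
   an increasing odd function because the noise is symmetric, independence of
   n(t) from the past gives E[x_i f(h(x_i) - h(x_j) - n_ij)] = E[x_i F(h(x_i) - h(x_j))],
   and summing over both orientations of every edge the drift of V is -2 alpha D(X)
   with D(X) = 1/2 sum (x_i - x_j) F(h(x_i) - h(x_j)) >= 0, up to O(alpha^2).
   Stopping when V exceeds lam and telescoping bounds by K/lam, with K independent
   of lam, the probability that either V ever exceeds lam or sum alpha D(X) exceeds
   lam/2. On the complementary event X stays in a ball, where D is bounded below as
   soon as |x_i - x_j| >= eps on some edge; since sum alpha = oo, sum alpha D < oo and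
   |x_i - x_j| moves by O(alpha) at each step, it tends to 0 along every edge, hence
   for every pair of vertices. Letting lam tend to infinity gives probability one. *)

(** * Deterministic estimates for monotone functions and real sequences *)

(** As [h] may be discontinuous, compactness does not give [m]. Instead a grid of mesh [delta / 2]
    is laid from [- B]: an interval of length [delta] starting to the right of [- B] contains a
    whole cell, and only finitely many cells matter, so [m] is a minimum of finitely many increments
    of [h]. *)
Lemma increasing_gap (R : realType) (h : R -> R) (B delta : R) :
  {homo h : x y / x < y} -> 0 < delta ->
  exists2 m : R, 0 < m &
    forall x y, - B <= y -> x <= B -> y + delta <= x -> h y + m <= h x.
Proof.
move=> h_incr delta_gt0.
have h_nd : {homo h : x y / x <= y} by exact: ltW_homo.
pose s := delta / 2.
have s_gt0 : 0 < s by rewrite divr_gt0.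
have gap (k : nat) : exists2 m : R, 0 < m &
    forall y, - B <= y <= - B + k%:R * s -> h y + m <= h (y + delta).
  elim: k => [|k [m m_gt0 IH]].
    exists (h (- B + delta) - h (- B)).
      by rewrite subr_gt0 h_incr// ltrDl.
    move=> y; rewrite mul0r addr0 => /andP[By yB].
    have -> : y = - B by apply/eqP; rewrite eq_le yB By.
    by rewrite addrC subrK.
  (* The increment over the grid cell that lies inside [[y, y + delta]] when [y] is in the cell just
     before it. *)
  pose m' := h (- B + k.+2%:R * s) - h (- B + k.+1%:R * s).
  have m'_gt0 : 0 < m'.
    by rewrite subr_gt0 h_incr// ltrD2l ltr_pM2r// ltr_nat.
  exists (Num.min m m'); first by rewrite lt_min m_gt0.
  move=> y /andP[By yB].
  have [yk|ky] := leP y (- B + k%:R * s).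
    apply: (@le_trans _ _ (h y + m)); first by rewrite lerD2l ge_min lexx.
    by apply: IH; rewrite By.
  apply: (@le_trans _ _ (h y + m')).
    by rewrite lerD2l ge_min lexx orbT.
  have h1 : h y <= h (- B + k.+1%:R * s) by exact: h_nd.
  have h2 : h (- B + k.+2%:R * s) <= h (y + delta).
    apply: h_nd; move: ky; have -> : delta = s + s by exact: splitr.
    by rewrite -addn2 natrD; lra.
  by rewrite /m'; lra.
have [k Bk] : exists k : nat, B + B <= k%:R * s.
  exists (Num.truncn ((B + B) / s)).+1; rewrite -ler_pdivrMr//.
  exact/ltW/truncnS_gt.
have [m m_gt0 mP] := gap k; exists m => // x y By xB yx.
apply: le_trans (h_nd _ _ yx); apply: mP.
by rewrite By/=; move: Bk; lra.
Qed.

(* While [u >= eps] the increments of [u] are dominated by those of the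
   convergent series [sum alpha D], so after its last visit below [eps] the
   sequence cannot climb noticeably. *)
Lemma cvg0_of_summable_drift (R : realType) (u D alpha : nat -> R) (K B : R) :
  (forall t, 0 < alpha t) ->
  (forall L, exists t, L < \sum_(0 <= s < t) alpha s) ->
  alpha t @[t --> \oo] --> 0 ->
  (forall t, 0 <= D t) ->
  (forall t, \sum_(0 <= s < t) alpha s * D s <= B) ->
  0 <= K -> (forall t, 0 <= u t) -> (forall t, u t.+1 <= u t + K * alpha t) ->
  (forall eps, 0 < eps -> exists2 c, 0 < c & forall t, eps <= u t -> c <= D t) ->
  u t @[t --> \oo] --> 0.
Proof.
move=> alpha_gt0 alpha_dvg alpha0 D_ge0 DB K_ge0 u_ge0 u_step Dlow.
pose S t := \sum_(0 <= s < t) alpha s * D s.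
have SS t : S t.+1 = S t + alpha t * D t by rewrite /S big_nat_recr.
have S_nd : {homo S : n m / (n <= m)%N >-> n <= m}.
  apply/nondecreasing_seqP => t.
  by rewrite SS lerDl mulr_ge0// ltW.
have S_cvg : cvgn S.
  apply: nondecreasing_is_cvgn => //.
  by exists B => _ [t _ <-]; exact: DB.
apply/cvgrPdist_le => eps eps_gt0.
(* One third each for the value at the last visit below [eta], for the single jump out of that
   region, and for the climb paid by the tail of [S]. Dividing by [K + 1] below covers the case
   [K = 0]. *)
pose eta := eps / 3.
have eta_gt0 : 0 < eta by rewrite divr_gt0.
have [c c_gt0 cP] := Dlow _ eta_gt0.
have K1_gt0 : 0 < K + 1 by rewrite ltr_wpDl.
have [T1 _ T1P] : \forall t \near \oo, alpha t <= eta / (K + 1).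
  have /cvgrPdist_le/(_ (eta / (K + 1))) := alpha0.
  rewrite divr_gt0// => /(_ isT) [n _ nP]; exists n => // t /nP /=.
  by rewrite sub0r normrN ger0_norm// ltW.
have [T2 _ T2P] : \forall t \near \oo, limn S - S t <= eta * c / (K + 1).
  have /cvgrPdist_le/(_ (eta * c / (K + 1))) := S_cvg.
  rewrite divr_gt0 ?mulr_gt0// => /(_ isT) [n _ nP]; exists n => // t /nP /=.
  exact/le_trans/ler_norm.
pose T0 := maxn T1 T2.
(* If [u] stayed above [eta] from [T0] on, then [D >= c] there, and the partial sums of [alpha]
   after [T0] would be at most [(B - S T0) / c], against divergence. *)
have [T3 T03 uT3] : exists2 T3, (T0 <= T3)%N & u T3 < eta.
  apply: contrapT => noT.
  have uge t : (T0 <= t)%N -> eta <= u t.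
    by move=> T0t; rewrite leNgt; apply/negP => ut; apply: noT; exists t.
  have [t] := alpha_dvg (\sum_(0 <= s < T0) alpha s + (B - S T0) / c).
  apply/negP; rewrite -leNgt.
  have [tT|Tt] := leqP t T0.
    apply: (@le_trans _ _ (\sum_(0 <= s < T0) alpha s)).
      rewrite [leRHS](big_cat_nat (n := t))//= lerDl.
      by apply: sumr_ge0 => s _; rewrite ltW.
    by rewrite lerDl divr_ge0 ?subr_ge0 ?(ltW c_gt0)//; exact: DB.
  rewrite (big_cat_nat (n := T0))//= ?(ltnW Tt)// lerD2l ler_pdivlMr//.
  apply: (@le_trans _ _ (S t - S T0)); last by rewrite lerD2r; exact: DB.
  rewrite /S [in leRHS](big_cat_nat (n := T0))//= ?(ltnW Tt)// addrAC subrr add0r.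
  rewrite mulr_suml; apply: ler_sum_nat => s /andP[Ts st].
  by rewrite ler_pM2l//; exact/cP/uge.
exists T3 => // t /= T3t; rewrite sub0r normrN ger0_norm//.
(* Below [eta], one step leads to at most [eta + eta] whatever happened before; above it, [c <= D]
   makes the step [K * alpha] at most [K / c] times the increment of [S]. *)
have climb k : u (T3 + k)%N <= eta + eta + (K / c) * (S (T3 + k)%N - S T3).
  elim: k => [|k IH].
    by rewrite addn0 subrr mulr0 addr0 (le_trans (ltW uT3))// lerDl ltW.
  rewrite addnS SS; apply: le_trans (u_step _) _.
  have T0k : (T0 <= T3 + k)%N by exact: leq_trans T03 (leq_addr _ _).
  have Kc_ge0 : 0 <= K / c by rewrite divr_ge0// ltW.
  have [ul|ug] := ltP (u (T3 + k)%N) eta.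
    have a1 : K * alpha (T3 + k)%N <= eta.
      apply: (@le_trans _ _ ((K + 1) * alpha (T3 + k)%N)).
        by rewrite ler_wpM2r ?lerDl// ltW.
      rewrite mulrC -ler_pdivlMr//; apply: T1P => /=.
      exact: leq_trans (leq_maxl _ _) T0k.
    have a2 : 0 <= K / c * (S (T3 + k)%N + alpha (T3 + k)%N * D (T3 + k)%N - S T3).
      rewrite mulr_ge0// -SS subr_ge0 S_nd//.
      exact: leq_trans (leq_addr _ _) (leqnSn _).
    by apply: le_trans (lerD (ltW ul) a1) _; rewrite lerDl.
  have a3 : K * alpha (T3 + k)%N <= K / c * (alpha (T3 + k)%N * D (T3 + k)%N).
    have -> : K * alpha (T3 + k)%N = K / c * (alpha (T3 + k)%N * c).
      by rewrite [alpha _ * _]mulrC mulrA divfK ?lt0r_neq0.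
    by rewrite ler_wpM2l// ler_pM2l//; exact: cP.
  apply: le_trans (lerD IH a3) _.
  by rewrite -addrA lerD2l -mulrDr addrAC.
rewrite -(subnKC T3t); apply: le_trans (climb _) _.
have St : S (T3 + (t - T3))%N - S T3 <= eta * c / (K + 1).
  apply: le_trans (T2P T3 _); last exact: leq_trans (leq_maxr _ _) T03.
  by rewrite lerD2r; exact: nondecreasing_cvgn_le.
have l3 : K / c * (S (T3 + (t - T3))%N - S T3) <= eta.
  apply: le_trans (ler_wpM2l _ St) _; first by rewrite divr_ge0// ltW.
  have -> : K / c * (eta * c / (K + 1)) = eta * (K / (K + 1)).
    by field; rewrite !lt0r_neq0.
  by rewrite ler_piMr ?(ltW eta_gt0)// ler_pdivrMr// mul1r lerDl.
have -> : eps = eta + eta + eta by rewrite /eta; lra.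
by rewrite lerD2l.
Qed.

(** * Bounded measurable functions and their integrals *)

(** With a fixed initial state and bounded [f], the state at each fixed time is bounded. All
    integrands of the drift argument thus lie in this class, which is closed under sums and products
    and integrable for every finite measure. *)
Definition bounded_measurable (R : realType) (d : measure_display)
    (T : measurableType d) (g : T -> R) : Prop :=
  measurable_fun [set: T] g /\ exists B : R, forall w, `|g w| <= B.

Section bounded_measurable.
Context {R : realType} {d : measure_display} {T : measurableType d}.
Implicit Types g : T -> R.

Lemma bounded_measurable_cst (c : R) : bounded_measurable (fun _ : T => c).
Proof. by split; [exact: measurable_cst|exists `|c|]. Qed.

Lemma bounded_measurableD g1 g2 :
  bounded_measurable g1 -> bounded_measurable g2 ->
  bounded_measurable (fun w => g1 w + g2 w).
Proof.
move=> [m1 [B1 b1]] [m2 [B2 b2]]; split; first exact: measurable_funD.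
by exists (B1 + B2) => w; apply: le_trans (ler_normD _ _) _; exact: lerD.
Qed.

Lemma bounded_measurableM g1 g2 :
  bounded_measurable g1 -> bounded_measurable g2 ->
  bounded_measurable (fun w => g1 w * g2 w).
Proof.
move=> [m1 [B1 b1]] [m2 [B2 b2]]; split; first exact: measurable_funM.
by exists (B1 * B2) => w; rewrite normrM ler_pM.
Qed.

Lemma bounded_measurableN g :
  bounded_measurable g -> bounded_measurable (fun w => - g w).
Proof.
move=> [m1 [B1 b1]]; split; first exact: measurableT_comp.
by exists B1 => w; rewrite normrN.
Qed.

Lemma bounded_measurableB g1 g2 :
  bounded_measurable g1 -> bounded_measurable g2 ->
  bounded_measurable (fun w => g1 w - g2 w).
Proof.
by move=> b1 b2; apply: bounded_measurableD => //; exact: bounded_measurableN.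
Qed.

Lemma bounded_measurable_sum (I : Type) (s : seq I) (p : pred I) (g : I -> T -> R) :
  (forall i, p i -> bounded_measurable (g i)) ->
  bounded_measurable (fun w => \sum_(i <- s | p i) g i w).
Proof.
move=> bg; elim: s => [|i s IH].
  rewrite [X in bounded_measurable X](_ : _ = fun=> 0); first exact: bounded_measurable_cst.
  by apply/funext => w; rewrite big_nil.
rewrite [X in bounded_measurable X](_ : _ = fun w => (if p i then g i w else 0) +
  \sum_(i <- s | p i) g i w); last first.
  by apply/funext => w; rewrite big_cons; case: ifP; rewrite ?add0r.
apply: bounded_measurableD => //.
by case: (boolP (p i)) => [/bg//|_]; exact: bounded_measurable_cst.
Qed.

Lemma bounded_measurable_integrable (mu : {finite_measure set T -> \bar R}) g :
  bounded_measurable g -> mu.-integrable [set: T] (EFin \o g).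
Proof.
move=> [mg [B gB]]; apply: measurable_bounded_integrable => //.
  by rewrite ltey_eq fin_num_measure.
exists B; split; first exact: num_real.
by move=> M BM w _ /=; apply: le_trans (gB w) (ltW BM).
Qed.

Lemma Rintegral_sum (mu : {finite_measure set T -> \bar R}) (I : Type)
    (s : seq I) (p : pred I) (g : I -> T -> R) :
  (forall i, p i -> bounded_measurable (g i)) ->
  \int[mu]_w (\sum_(i <- s | p i) g i w) = \sum_(i <- s | p i) \int[mu]_w g i w.
Proof.
move=> bg; elim: s => [|i s IH].
  rewrite big_nil; under eq_Rintegral do rewrite big_nil.
  by rewrite Rintegral_cst// mul0r.
rewrite big_cons; under eq_Rintegral do rewrite big_cons.
have [pi|//] := ifP; rewrite RintegralD ?IH//.
- by apply: bounded_measurable_integrable; exact: bg.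
- by apply: bounded_measurable_integrable; exact: bounded_measurable_sum.
Qed.

End bounded_measurable.

Lemma bounded_measurable_comp (R : realType) (d d' : measure_display)
    (T : measurableType d) (T' : measurableType d') (phi : T -> T') (g : T' -> R) :
  measurable_fun [set: T] phi -> bounded_measurable g ->
  bounded_measurable (g \o phi).
Proof.
move=> mphi [mg [B gB]]; split; first exact: measurableT_comp.
by exists B => w; exact: gB.
Qed.

Lemma Rintegral_probability_bounded (R : realType) (d : measure_display)
    (T : measurableType d) (P : probability T R) (g : T -> R) (M : R) :
  measurable_fun [set: T] g -> (forall w, `|g w| <= M) -> `|\int[P]_w g w| <= M.
Proof.
move=> mg gM.
have bg : bounded_measurable g by split=> //; exists M.
have bng : bounded_measurable (fun w => `|g w|).
  by split; [exact: measurableT_comp|exists M => w; rewrite normr_id].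
apply: le_trans (le_normr_Rintegral measurableT (bounded_measurable_integrable P bg)) _.
apply: (@le_trans _ _ (\int[P]_w M)).
  apply: le_Rintegral => //; apply: bounded_measurable_integrable => //.
  exact: bounded_measurable_cst.
by rewrite Rintegral_cst// [X in fine X]probability_setT mulr1.
Qed.

Lemma Rintegral_distribution (R : realType) (d d' : measure_display)
    (T : measurableType d) (T' : measurableType d') (P : probability T R)
    (X : {mfun T >-> T'}) (g : T' -> R) :
  bounded_measurable g ->
  \int[distribution P X]_y g y = \int[P]_w g (X w).
Proof.
move=> bg; rewrite /Rintegral integral_distribution//.
  by apply/measurable_EFinP; exact: bg.1.
apply: (bounded_measurable_integrable P (g := g \o X)).
exact: bounded_measurable_comp.
Qed.

(** The joint law of [(X, Y)] agrees with the product of the marginals on rectangles, hence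
    everywhere; Fubini then integrates [Y] out first. *)
Lemma Rintegral_independent (R : realType) (d d1 d2 : measure_display)
    (T : measurableType d) (T1 : measurableType d1) (T2 : measurableType d2)
    (P : probability T R) (X : {mfun T >-> T1}) (Y : {mfun T >-> T2})
    (g : T1 * T2 -> R) :
  (forall A B, measurable A -> measurable B ->
    P (X @^-1` A `&` Y @^-1` B) = (P (X @^-1` A) * P (Y @^-1` B))%E) ->
  bounded_measurable g ->
  \int[P]_w g (X w, Y w) = \int[P]_w (\int[distribution P Y]_y g (X w, y)).
Proof.
move=> XY bg.
have mXY : measurable_fun [set: T] (fun w => (X w, Y w)).
  exact: measurable_fun_pair.
pose XYb := isMeasurableFun.Build _ _ _ _ (fun w => (X w, Y w)) mXY.
pose Z : {mfun T >-> (T1 * T2)%type} := HB.pack (fun w => (X w, Y w)) XYb.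
rewrite -[LHS](Rintegral_distribution P Z)//.
pose m1 := distribution P X. pose m2 := distribution P Y.
have eqm : forall A, measurable A -> (m1 \x m2)%E A = distribution P Z A.
  by apply: product_measure_unique => A B mA mB; exact: XY.
transitivity (\int[(m1 \x m2)%E]_z g z).
  by congr fine; apply: eq_measure_integral => A mA _; exact/esym/eqm.
have ig : (m1 \x m2)%E.-integrable setT (EFin \o g).
  case: bg => mg [B gB]; apply: measurable_bounded_integrable => //.
    by rewrite [ltLHS]eqm// ltey_eq fin_num_measure.
  exists B; split; first exact: num_real.
  by move=> M BM w _ /=; apply: le_trans (gB w) (ltW BM).
have bgX x : bounded_measurable (fun y => g (x, y)).
  by case: bg => mg [B gB]; split; [exact: measurableT_comp|exists B].
pose G x := \int[distribution P Y]_y g (x, y).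
have GE x : (\int[distribution P Y]_y (g (x, y))%:E)%E = (G x)%:E.
  by rewrite /G /Rintegral fineK// integrable_fin_num//; exact: bounded_measurable_integrable.
have bG : bounded_measurable G.
  split; last first.
    have [_ [B gB]] := bg; exists B => x.
    by apply: Rintegral_probability_bounded => [|y]; [have [] := bgX x|exact: gB].
  apply/measurable_EFinP.
  rewrite [X in measurable_fun _ X](_ : _ = fubini_F m2 (EFin \o g)).
    exact: measurable_fubini_F ig.
  by apply/funext => x; rewrite /= -GE.
transitivity (\int[distribution P X]_x G x); last exact: Rintegral_distribution.
rewrite /Rintegral -integral12_prod_meas1//; congr fine.
by apply: eq_integral => x _; rewrite -GE.
Qed.

(** * Step-size series, null sequences and null events *)

Section step_sizes.
Context {R : realType} (a : nat -> R).
Hypothesis a_ge0 : forall t, 0 <= a t.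

Lemma nneseries_pinfty_unbounded : (\sum_(0 <= t <oo) (a t)%:E = +oo)%E ->
  forall L, exists t, L < \sum_(0 <= s < t) a s.
Proof.
move=> aoo L; apply: contrapT => nL.
have : (\sum_(0 <= t <oo) (a t)%:E <= L%:E)%E.
  apply: lime_le; first by apply: is_cvg_nneseries => t _ _; rewrite lee_fin.
  apply: nearW => t; rewrite sumEFin lee_fin leNgt.
  by apply/negP => La; apply: nL; exists t.
by rewrite aoo leye_eq.
Qed.

Lemma nneseries_lty_bounded : (\sum_(0 <= t <oo) (a t)%:E < +oo)%E ->
  exists L, forall t, \sum_(0 <= s < t) a s <= L.
Proof.
move=> aoo; exists (fine (\sum_(0 <= t <oo) (a t)%:E)%E) => t.
rewrite -lee_fin fineK; last first.
  by rewrite ge0_fin_numE// nneseries_ge0// => s _ _; rewrite lee_fin.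
by rewrite -sumEFin; apply: nneseries_lim_ge => s _ _; rewrite lee_fin.
Qed.

Lemma cvg0_of_bounded_series (L : R) :
  (forall t, \sum_(0 <= s < t) a s <= L) -> a t @[t --> \oo] --> 0.
Proof.
move=> aL; apply: cvg_series_cvg_0; apply: nondecreasing_is_cvgn.
  by apply/nondecreasing_seqP => t; rewrite /series/= big_nat_recr//= lerDl.
by exists L => _ [t _ <-]; exact: aL.
Qed.

End step_sizes.

Lemma cvg0_of_sqr (R : realType) (a : nat -> R) :
  (a t) ^+ 2 @[t --> \oo] --> (0 : R) -> a t @[t --> \oo] --> (0 : R).
Proof.
move=> a0; apply/cvgrPdist_le => eps eps_gt0.
have /cvgrPdist_le/(_ (eps ^+ 2)) := a0.
rewrite exprn_gt0// => /(_ isT) [m _ mP]; exists m => // t /mP /=.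
rewrite !sub0r !normrN normrX ler_pXn2r// nnegrE//; exact: ltW.
Qed.

(** With tolerances restricted to [1 / (m + 1)], every quantifier in the definition of the limit is
    countable. *)
Lemma measurable_cvg0 (R : realType) (d : measure_display) (T : measurableType d)
    (Y : nat -> T -> R) : (forall t, measurable_fun [set: T] (Y t)) ->
  measurable [set w | Y t w @[t --> \oo] --> (0 : R)].
Proof.
move=> mY.
have -> : [set w | Y t w @[t --> \oo] --> (0 : R)] =
    \bigcap_m \bigcup_t0 \bigcap_t [set w | `|Y (t0 + t)%N w| <= m.+1%:R^-1].
  apply/seteqP; split=> [w /cvgrPdist_le Y0 m _ /=|w Yw].
    have [] := Y0 m.+1%:R^-1; first by rewrite invr_gt0.
    move=> t0 _ t0P; exists t0 => // t _ /=.
    by have := t0P _ (leq_addr t t0); rewrite /= sub0r normrN.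
  apply/cvgrPdist_le => eps eps_gt0.
  have [m meps] : exists m : nat, m.+1%:R^-1 <= eps.
    exists (Num.truncn eps^-1); rewrite -[leRHS]invrK lef_pV2 ?posrE ?invr_gt0//.
    exact/ltW/truncnS_gt.
  have [t0 _ t0P] := Yw m I; exists t0 => // t /= t0t.
  rewrite sub0r normrN; apply: le_trans meps.
  by have := t0P (t - t0)%N I; rewrite /= subnKC.
apply: bigcap_measurable => // m _; apply: bigcup_measurable => t0 _.
apply: bigcap_measurable => // t _.
have mY1 : measurable_fun [set: T] (fun w => `|Y (t0 + t)%N w|).
  by apply: measurableT_comp.
have -> : [set w | `|Y (t0 + t)%N w| <= m.+1%:R^-1] =
    (fun w => `|Y (t0 + t)%N w|) @^-1` `]-oo, m.+1%:R^-1].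
  by apply/seteqP; split=> w /=; rewrite in_itv.
by rewrite -[X in measurable X]setTI; exact: mY1.
Qed.

Lemma probability0_of_le_div (R : realType) (d : measure_display)
    (T : measurableType d) (P : probability T R) (A : set T) (K : R) :
  measurable A -> 0 <= K ->
  (forall lam, 0 < lam -> (P A <= (K / lam)%:E)%E) -> P A = 0%E.
Proof.
move=> mA K_ge0 PK; have fPA : P A \is a fin_num by exact: fin_num_measure.
rewrite -(fineK fPA); congr (_%:E); set p := fine (P A).
have p_ge0 : 0 <= p by exact: fine_ge0.
apply/eqP; rewrite eq_le p_ge0 andbT leNgt; apply/negP => p_gt0.
(* For this [lam] the bound reads [p <= K * p / (K + 1)], impossible when [p > 0]. *)
have := PK ((K + 1) / p); rewrite divr_gt0 ?ltr_wpDl// => /(_ isT).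
rewrite -(fineK fPA) lee_fin -/p invf_div mulrA ler_pdivlMr ?ltr_wpDl//.
by nra.
Qed.

(** * Distance to the consensus subspace and pairwise differences *)

Section euclidean.
Context {R : realType} {N : nat}.
Implicit Types x : 'cV[R]_N.

Lemma euclidean_norm_le_sum x : euclidean_norm x <= \sum_i `|x i 0|.
Proof.
have s_ge0 : 0 <= \sum_i `|x i 0| by apply: sumr_ge0.
rewrite /euclidean_norm -[leRHS]ger0_norm// -sqrtr_sqr; apply: ler_wsqrtr.
rewrite expr2 mulr_suml; apply: ler_sum => i _.
rewrite -real_normK ?num_real// expr2 ler_wpM2l//.
by rewrite (bigD1 i)//= lerDl sumr_ge0.
Qed.

Lemma le_euclidean_norm x i : `|x i 0| <= euclidean_norm x.
Proof.
rewrite -sqrtr_sqr; apply: ler_wsqrtr.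
by rewrite (bigD1 i)//= lerDl sumr_ge0// => j _; exact: sqr_ge0.
Qed.

Let distances x := [set euclidean_norm (x - z) | z in @consensus_subspace R N].

Let distances_lb x : lbound (distances x) 0.
Proof. by move=> _ [z _ <-]; exact: sqrtr_ge0. Qed.

Lemma euclidean_dist_ge0 x : 0 <= euclidean_dist x (@consensus_subspace R N).
Proof.
apply: lb_le_inf; last exact: distances_lb.
by exists (euclidean_norm (x - 0 *: const_mx 1)), (0 *: const_mx 1) => //; exists 0.
Qed.

Lemma euclidean_dist_le_sum x k :
  euclidean_dist x (@consensus_subspace R N) <= \sum_i `|x i 0 - x k 0|.
Proof.
apply: (@le_trans _ _ (euclidean_norm (x - x k 0 *: const_mx 1))).
  apply: ge_inf; first by exists 0; exact: distances_lb.
  by exists (x k 0 *: const_mx 1) => //; exists (x k 0).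
apply: le_trans (euclidean_norm_le_sum _) _.
by apply: ler_sum => i _; rewrite !mxE mulr1.
Qed.

Lemma le_euclidean_dist x i k :
  `|x i 0 - x k 0| <= 2 * euclidean_dist x (@consensus_subspace R N).
Proof.
rewrite -ler_pdivrMl//; apply: lb_le_inf.
  by exists (euclidean_norm (x - 0 *: const_mx 1)), (0 *: const_mx 1) => //; exists 0.
move=> _ [_ [a ->] <-]; rewrite ler_pdivrMl//.
have bd l : `|x l 0 - a| <= euclidean_norm (x - a *: const_mx 1).
  by have := le_euclidean_norm (x - a *: const_mx 1) l; rewrite !mxE mulr1.
have -> : x i 0 - x k 0 = (x i 0 - a) - (x k 0 - a) by lra.
apply: le_trans (ler_normB _ _) _.
by have := bd i; have := bd k; lra.
Qed.

(** Trades the infimum for a finite sum of differences with one reference vertex, which is visibly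
    measurable and can be controlled edge by edge. *)
Lemma cvg_euclidean_dist (x : nat -> 'cV[R]_N) k :
  (euclidean_dist (x t) (@consensus_subspace R N) @[t --> \oo] --> (0 : R)) <->
  (\sum_i `|x t i 0 - x t k 0| @[t --> \oo] --> (0 : R)).
Proof.
split=> x0.
  apply: (@squeeze_cvgr _ _ _ _ (fun=> 0)
    (fun t => \sum_(i < N) 2 * euclidean_dist (x t) (@consensus_subspace R N))).
  - apply: nearW => t; rewrite sumr_ge0//=.
    by apply: ler_sum => i _; exact: le_euclidean_dist.
  - exact: cvg_cst.
  - under eq_fun do rewrite sumr_const card_ord -[_ *+ _]mulr_natl mulrA.
    suff : N%:R * 2 * euclidean_dist (x t) (@consensus_subspace R N)
        @[t --> \oo] --> N%:R * 2 * (0 : R) by rewrite mulr0.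
    by apply: cvgM => //; exact: cvg_cst.
apply: (@squeeze_cvgr _ _ _ _ (fun=> 0) (fun t => \sum_i `|x t i 0 - x t k 0|)) => //.
  by apply: nearW => t; rewrite euclidean_dist_ge0 euclidean_dist_le_sum.
exact: cvg_cst.
Qed.

Lemma connected_consensus (e : rel 'I_N) (x : nat -> 'cV[R]_N) :
  (forall i j, e i j -> `|x t i 0 - x t j 0| @[t --> \oo] --> (0 : R)) ->
  forall i j, connect e i j -> `|x t i 0 - x t j 0| @[t --> \oo] --> (0 : R).
Proof.
move=> xe i j /connectP[p]; elim: p i => [|k p IH] i /=.
  move=> _ ->; under eq_fun do rewrite subrr normr0; exact: cvg_cst.
move=> /andP[eik kp] jE.
apply: (@squeeze_cvgr _ _ _ _ (fun=> 0)
    (fun t => `|x t i 0 - x t k 0| + `|x t k 0 - x t j 0|)).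
- by apply: nearW => t; rewrite normr_ge0/= ler_distD.
- exact: cvg_cst.
- suff : `|x t i 0 - x t k 0| + `|x t k 0 - x t j 0| @[t --> \oo] --> (0 + 0 : R).
    by rewrite addr0.
  by apply: cvgD; [exact: xe|exact: IH].
Qed.

End euclidean.

(** * Independence of one variable from the sigma-algebra of others *)

Section cylinder.
Context {R : realType} {d : measure_display} {T : measurableType d}.
Context {P : probability T R} {I : eqType}.
Variables (K : set I) (X : I -> {RV P >-> R}).

(** A pi-system generating the sigma-algebra of the variables indexed by [K]. Repetitions in [s] are
    allowed, so that two cylinders intersect by concatenating their lists. *)
Definition cylinder : set (set T) :=
  [set A | exists (s : seq I) (B : I -> set R),
    [/\ forall k, k \in s -> K k, forall k, measurable (B k) &
        A = \bigcap_(k in [set` s]) (X k @^-1` B k)]].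

Lemma cylinder_measurable : cylinder `<=` measurable.
Proof.
move=> _ [s [B [_ mB ->]]]; elim: s => [|k s IH].
  by rewrite (_ : mkset _ = set0) ?bigcap_set0//; apply/seteqP; split.
rewrite (_ : mkset _ = [set k] `|` [set` s]).
  by rewrite bigcap_setU bigcap_set1; apply: measurableI => //; exact: measurable_funPTI.
by apply/seteqP; split=> l /=; rewrite inE => /predU1P.
Qed.

Lemma cylinder_setI : setI_closed cylinder.
Proof.
move=> _ _ [s1 [B1 [Ks1 mB1 ->]]] [s2 [B2 [Ks2 mB2 ->]]].
pose B k := (if k \in s1 then B1 k else setT) `&` (if k \in s2 then B2 k else setT).
exists (s1 ++ s2), B; split.
- by move=> k; rewrite mem_cat => /orP[/Ks1|/Ks2].
- by move=> k; apply: measurableI; case: ifP.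
- apply/seteqP; split=> [w [w1 w2] k /= _|w wB].
    by split; case: ifP => // ks; [exact: w1|exact: w2].
  split=> k /= ks.
    by have := wB k; rewrite /= mem_cat ks => /(_ isT) []; rewrite ks.
  by have := wB k; rewrite /= mem_cat ks orbT => /(_ isT) []; rewrite ks.
Qed.

Lemma cylinder_setT : cylinder setT.
Proof.
exists [::], (fun=> setT); split=> //.
by apply/seteqP; split=> // w _ k /=; rewrite in_nil.
Qed.

Lemma measurable_fun_cylinder k : K k ->
  measurable_fun [set: g_sigma_algebraType cylinder] (X k).
Proof.
move=> Kk _ B mB; rewrite setTI; apply: sub_sigma_algebra.
exists [:: k], (fun=> B); split=> //; first by move=> l; rewrite inE => /eqP ->.
apply/seteqP; split=> [w wB l /=|w]; first by rewrite inE => /eqP ->.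
by apply => /=; rewrite inE.
Qed.

Lemma sub_cylinder_measurable (A : set T) : <<s cylinder >> A -> measurable A.
Proof.
by apply: smallest_sub; [exact: sigma_algebra_measurable|exact: cylinder_measurable].
Qed.

(** As functions of [A], both sides are finite measures. They agree on cylinders by mutual
    independence, hence on the generated sigma-algebra. *)
Lemma independent_cylinder (K0 : set I) (k0 : I) (A : set T) (B : set R) :
  mutually_independent K0 X -> K `<=` K0 -> K0 k0 -> ~ K k0 ->
  <<s cylinder >> A -> measurable B ->
  P (A `&` X k0 @^-1` B) = (P A * P (X k0 @^-1` B))%E.
Proof.
move=> indep KK0 K0k0 nKk0 sA mB.
have mXB : measurable (X k0 @^-1` B) by exact: measurable_funPTI.
have PB_ge0 : 0 <= fine (P (X k0 @^-1` B)) by exact: fine_ge0.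
pose r := NngNum PB_ge0.
have PBE : (P (X k0 @^-1` B) = r%:num%:E)%E by rewrite /= fineK// fin_num_measure.
have -> : (P A * P (X k0 @^-1` B) = mscale r P A)%E by rewrite muleC PBE.
apply: (g_sigma_algebra_measure_unique cylinder cylinder_measurable (fun=> setT)
  _ _ (mrestr P mXB) (mscale r P)) => //.
- by move=> _; exact: cylinder_setT.
- by rewrite bigcup_const.
- exact: cylinder_setI.
- move=> _ [s [B' [Ks mB' ->]]].
  (* Merges both events into one cylinder. The list [k0 :: undup s] has distinct entries because the
     indices in [s] satisfy [K] and [k0] does not. *)
  pose C k := if k == k0 then B else B' k.
  have usk0 : uniq (k0 :: undup s).
    by rewrite /= undup_uniq andbT mem_undup; apply/negP => /Ks.
  have mC k : measurable (C k) by rewrite /C; case: ifP.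
  have CB' k : k \in undup s -> C k = B' k.
    by rewrite mem_undup /C => /Ks Kk; case: eqP => // kk0; rewrite kk0 in Kk.
  have -> : \bigcap_(k in [set` s]) (X k @^-1` B' k) =
      \bigcap_(k in [set` undup s]) (X k @^-1` C k).
    apply/seteqP; split=> w wB k /= ks.
      by rewrite CB'//; apply: wB => /=; rewrite -mem_undup.
    by rewrite -CB' ?mem_undup//; apply: wB => /=; rewrite mem_undup.
  transitivity (P (\bigcap_(k in [set` k0 :: undup s]) (X k @^-1` C k))).
    rewrite /= /mrestr; congr (P _).
    apply/seteqP; split=> [w [w1 w2] k /=|w wC].
      rewrite inE => /predU1P[->|/w1//]; by rewrite /C eqxx.
    split=> [k ks|]; first by apply: wC => /=; rewrite inE ks orbT.
    by have := wC k0; rewrite /= inE eqxx /C eqxx; apply.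
  rewrite indep//; last first.
    by move=> k; rewrite inE => /predU1P[->//|]; rewrite mem_undup => /Ks /KK0.
  rewrite big_cons {1}/C eqxx /= /mscale /= indep//.
  - by rewrite PBE.
  - exact: undup_uniq.
  - by move=> k; rewrite mem_undup => /Ks /KK0.
- move=> _; rewrite /= /mrestr setTI.
  by rewrite ltey_eq fin_num_measure.
Qed.

(** Stands in for conditioning on the variables of [K]: the identity, seen as a map into [T] with
    the coarser sigma-algebra, is a random element independent of [X k0]. *)
Lemma Rintegral_cylinder (K0 : set I) (k0 : I)
    (g : g_sigma_algebraType cylinder * R -> R) :
  mutually_independent K0 X -> K `<=` K0 -> K0 k0 -> ~ K k0 ->
  bounded_measurable g ->
  \int[P]_w g (w, X k0 w) = \int[P]_w (\int[distribution P (X k0)]_y g (w, y)).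
Proof.
move=> indep KK0 K0k0 nKk0 bg.
have mid : measurable_fun [set: T] (idfun : T -> g_sigma_algebraType cylinder).
  by move=> _ A mA; rewrite setTI; exact: sub_cylinder_measurable.
pose idb := isMeasurableFun.Build _ _ _ _ _ mid.
pose J : {mfun T >-> g_sigma_algebraType cylinder} :=
  HB.pack (idfun : T -> g_sigma_algebraType cylinder) idb.
apply: (Rintegral_independent (X := J)) => // A B mA mB.
exact: (independent_cylinder indep KK0).
Qed.

End cylinder.

(** * The drift of the squared norm *)

Section drift.
Context {R : realType} {N : nat}.
Variables (e : rel 'I_N) (h F : R -> R).
Hypotheses (e_sym : symmetric e) (h_incr : {homo h : x y / x < y}).
Hypotheses (F_nd : {homo F : x y / x <= y}) (F_odd : forall x, F (- x) = - F x).
Hypothesis F_gt0 : forall x, 0 < x -> 0 < F x.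

Definition drift (x : 'I_N -> R) : R :=
  \sum_i \sum_(j < N | e i j) x i * F (h (x i) - h (x j)).

(** Exchanging the two ends of each edge flips the sign of the argument of the odd [F], so [x i] may
    be replaced by [- x j]; the two expressions are averaged. *)
Lemma driftE x : drift x =
  2^-1 * \sum_i \sum_(j < N | e i j) (x i - x j) * F (h (x i) - h (x j)).
Proof.
have driftN : drift x = - \sum_i \sum_(j < N | e i j) x j * F (h (x i) - h (x j)).
  rewrite /drift (exchange_big_dep predT)//= -sumrN; apply: eq_bigr => j _.
  rewrite -sumrN; apply: eq_big => [i|i _]; first exact: e_sym.
  by rewrite -mulrN -F_odd opprB.
suff -> : \sum_i \sum_(j < N | e i j) (x i - x j) * F (h (x i) - h (x j)) =
    drift x + drift x by lra.
rewrite {2}driftN -sumrB; apply: eq_bigr => i _.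
by rewrite -sumrB; apply: eq_bigr => j _; rewrite mulrBl.
Qed.

Lemma drift_term_ge0 (a b : R) : 0 <= (a - b) * F (h a - h b).
Proof.
wlog ba : a b / b <= a.
  move=> wl; have [|/ltW ab] := leP b a; first exact: wl.
  by rewrite -mulrNN -F_odd !opprB wl.
have h_nd : {homo h : x y / x <= y} by exact: ltW_homo.
have F0 : F 0 = 0 by have := F_odd 0; rewrite oppr0; lra.
by rewrite mulr_ge0 ?subr_ge0// -F0 F_nd// subr_ge0 h_nd.
Qed.

Lemma le_drift x i j : e i j ->
  2^-1 * ((x i - x j) * F (h (x i) - h (x j))) <= drift x.
Proof.
move=> eij; rewrite driftE ler_pM2l ?invr_gt0// (bigD1 i)//= (bigD1 j)//=.
rewrite -addrA lerDl addr_ge0 ?sumr_ge0// => k _; first exact: drift_term_ge0.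
by rewrite sumr_ge0// => l _; exact: drift_term_ge0.
Qed.

Lemma drift_ge0 x : 0 <= drift x.
Proof.
rewrite driftE mulr_ge0 ?invr_ge0// sumr_ge0// => i _.
by rewrite sumr_ge0// => j _; exact: drift_term_ge0.
Qed.

(** One edge term already bounds the nonnegative drift from below. On the ball, a gap [eps] in the
    states forces a uniform gap [m] after [h], and monotonicity of [F] gives at least [F m]. *)
Lemma drift_gap (lam eps : R) : 0 < eps ->
  exists2 c, 0 < c & forall x i j, e i j -> \sum_i x i ^+ 2 <= lam ->
    eps <= `|x i - x j| -> c <= drift x.
Proof.
move=> eps_gt0.
have [m m_gt0 mP] := increasing_gap (lam + 1) h_incr eps_gt0.
exists (2^-1 * (eps * F m)); first by rewrite !mulr_gt0 ?invr_gt0// F_gt0.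
move=> x i j eij xlam xij.
have lam_ge0 : 0 <= lam by apply: le_trans xlam; apply: sumr_ge0 => k _; exact: sqr_ge0.
(* From [x k ^+ 2 <= lam <= (lam + 1) ^+ 2], which avoids a square root. *)
have xb k : `|x k| <= lam + 1.
  have xk : x k ^+ 2 <= lam.
    by apply: le_trans xlam; rewrite (bigD1 k)//= lerDl sumr_ge0// => l _; exact: sqr_ge0.
  rewrite -(@ler_pXn2r _ 2%N)// ?nnegrE ?addr_ge0// real_normK ?num_real//.
  by apply: le_trans xk _; nra.
apply: le_trans (le_drift x eij); rewrite ler_pM2l ?invr_gt0//.
have key a b : `|a| <= lam + 1 -> `|b| <= lam + 1 -> eps <= a - b ->
    eps * F m <= (a - b) * F (h a - h b).
  rewrite !ler_norml => /andP[_ a1] /andP[b1 _] ab.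
  apply: ler_pM => //; [exact: ltW|exact/ltW/F_gt0|].
  by apply: F_nd; have := mP _ _ b1 a1; rewrite lerBrDl; apply; rewrite addrC -lerBrDr.
have [ji|/ltW ij] := leP (x j) (x i).
  by apply: key => //; rewrite -[leRHS]ger0_norm// subr_ge0.
rewrite -[leRHS]mulrNN -F_odd !opprB; apply: key => //.
by rewrite -[leRHS]ger0_norm ?subr_ge0// distrC.
Qed.

End drift.

(** * The nonlinearity averaged over the noise *)

Section smoothing.
Context {R : realType} (d : measure_display) (T : measurableType d).
Variables (P : probability T R) (Z : {RV P >-> R}) (f : R -> R) (M : R).
Hypotheses (f_incr : {homo f : x y / x < y}) (f_odd : forall x, f (- x) = - f x).
Hypotheses (fM : forall x, `|f x| <= M).
Hypothesis Z_sym : symmetric_about_zero Z.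

Definition smoothing (y : R) : R := \int[distribution P Z]_z f (y - z).

Let mf : measurable_fun [set: R] f.
Proof. by apply: nondecreasing_measurable => //; exact: ltW_homo. Qed.

Let bf y : bounded_measurable (fun z : R => f (y - z)).
Proof.
split; last by exists M => z; exact: fM.
by apply: measurableT_comp => //; exact: measurable_funB.
Qed.

Let iof y := bounded_measurable_integrable (distribution P Z) (bf y).

Lemma smoothing_nd : {homo smoothing : x y / x <= y}.
Proof.
move=> x y xy; apply: le_Rintegral => //.
by move=> z _; apply: (ltW_homo f_incr); rewrite lerD2r.
Qed.

Lemma smoothing_bounded y : `|smoothing y| <= M.
Proof.
by apply: Rintegral_probability_bounded => [|z]; [have [] := bf y|exact: fM].
Qed.

Lemma smoothing_odd y : smoothing (- y) = - smoothing y.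
Proof.
have -> : smoothing (- y) = \int[distribution P Z]_z - f (y + z).
  by apply: eq_Rintegral => z _; rewrite -opprD f_odd.
have bfD : bounded_measurable (fun z : R => f (y + z)).
  split; last by exists M => z; exact: fM.
  by apply: measurableT_comp => //; exact: measurable_funD.
under eq_Rintegral do rewrite -mulN1r.
rewrite RintegralZl//; last exact: bounded_measurable_integrable.
rewrite mulN1r; congr (- _).
have mN : measurable_fun [set: R] (-%R : R -> R) by exact: oppr_measurable.
pose Nb := isMeasurableFun.Build _ _ _ _ _ mN.
pose opp : {mfun R >-> R} := HB.pack (-%R : R -> R) Nb.
(* Symmetry of the noise: its law is its own image under negation, which turns [f (y - z)] into
   [f (y + z)]. *)
transitivity (\int[distribution (distribution P Z) opp]_z f (y + z)).
  congr fine; apply: eq_measure_integral => A mA _.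
  rewrite -[LHS]Z_sym//; congr (distribution P Z _).
  apply/seteqP; split=> [_ [x Ax <-] /=|x /= Ax]; first by rewrite opprK.
  by exists (- x) => //; rewrite opprK.
by rewrite Rintegral_distribution.
Qed.

(** Oddness gives value 0 at 0. If the value at [y] were 0 too, the everywhere positive function
    [f (y - z) - f (- z)] would have integral 0, hence vanish almost everywhere, making the whole
    line a null set. *)
Lemma smoothing_gt0 y : 0 < y -> 0 < smoothing y.
Proof.
move=> y_gt0.
have F0 : smoothing 0 = 0.
  by have := smoothing_odd 0; rewrite oppr0; lra.
have F_ge0 : 0 <= smoothing y by rewrite -F0 smoothing_nd// ltW.
rewrite lt0r F_ge0 andbT; apply/eqP => Fy0.
pose g z := f (y - z) - f (0 - z).
have g_gt0 z : 0 < g z by rewrite subr_gt0 f_incr// ltrD2r.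
have bg : bounded_measurable g by exact: bounded_measurableB.
have ig := bounded_measurable_integrable (distribution P Z) bg.
have Ig : \int[distribution P Z]_z g z = 0.
  rewrite RintegralB//.
  by rewrite -/(smoothing y) -/(smoothing 0) F0 Fy0 subrr.
have : ae_eq (distribution P Z) setT (EFin \o g) (cst 0%E).
  apply/ae_eq_integral_abs => //; first exact: measurable_int ig.
  rewrite (eq_integral (EFin \o g)); last first.
    by move=> z _; rewrite /= ger0_norm// ltW.
  by rewrite -[LHS]fineK ?integrable_fin_num// [fine _]Ig.
move=> [A [mA A0 /(_ _)sA]].
have AT : A = setT.
  apply/seteqP; split=> // z _; apply: sA => /= /(_ I) [gz].
  by have := g_gt0 z; rewrite gz ltxx.
by move: A0; rewrite AT [LHS]probability_setT => /eqP; rewrite onee_eq0.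
Qed.

End smoothing.

(** * Energy and the stopping indicator *)

Definition energy (R : realType) (N : nat) (x : 'cV[R]_N) : R :=
  \sum_i x i 0 ^+ 2.

(* Plays the role of the stopping time at which the energy first exceeds [lam]. *)
Definition alive (R : realType) (N : nat) (T : Type) (X : nat -> T -> 'cV[R]_N)
    (lam : R) (t : nat) (w : T) : R :=
  \prod_(0 <= s < t.+1) (energy (X s w) <= lam)%R%:R.

Section alive.
Context {R : realType} {N : nat} {T : Type} (X : nat -> T -> 'cV[R]_N) (lam : R).

Lemma aliveS t w :
  alive X lam t.+1 w = alive X lam t w * (energy (X t.+1 w) <= lam)%R%:R.
Proof. by rewrite /alive big_nat_recr. Qed.

Lemma alive_01 t w : alive X lam t w = 0 \/ alive X lam t w = 1.
Proof.
elim: t => [|t IH].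
  by rewrite /alive big_nat1; case: (_ <= _); [right|left].
rewrite aliveS; case: IH => ->; first by rewrite mul0r; left.
by rewrite mul1r; case: (_ <= _); [right|left].
Qed.

Lemma alive_ge0 t w : 0 <= alive X lam t w.
Proof. by case: (alive_01 t w) => ->. Qed.

Lemma alive_le1 t w : alive X lam t w <= 1.
Proof. by case: (alive_01 t w) => ->. Qed.

Lemma alive_nonincreasing t w : alive X lam t.+1 w <= alive X lam t w.
Proof. by rewrite aliveS ler_piMr ?alive_ge0// lern1 leq_b1. Qed.

Lemma alive1_energy t w : alive X lam t w = 1 -> energy (X t w) <= lam.
Proof.
case: t => [|t]; rewrite ?aliveS /alive ?big_nat1; case: (_ <= _) => //= /eqP.
  by rewrite eq_sym oner_eq0.
by rewrite mulr0 eq_sym oner_eq0.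
Qed.

End alive.

(** * Measurability of the state in terms of the past noise *)

Section state_measurability.
Context {R : realType} (N : nat) (e : rel 'I_N) (f h : R -> R) (alpha : nat -> R).
Hypotheses (mf : measurable_fun [set: R] f) (mh : measurable_fun [set: R] h).
Context (d : measure_display) (T : measurableType d).
Variables (n : nat * 'I_N * 'I_N -> T -> R) (X0 : 'cV[R]_N) (X : nat -> T -> 'cV[R]_N).
Hypothesis X_init : forall w, X 0%N w = X0.
Hypothesis X_step : forall (t : nat) (w : T) (i : 'I_N),
  X t.+1 w i 0 = X t w i 0 - alpha t *
    \sum_(j < N | e i j) f (h (X t w i 0) - h (X t w j 0) - n (t, i, j) w).
Variable t0 : nat.
Hypothesis mn : forall t i j, (t < t0)%N -> e i j ->
  measurable_fun [set: T] (n (t, i, j)).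

(** The sigma-algebra on [T] is left open and only edge noises before [t0] need be measurable for
    it. The original sigma-algebra gives plain measurability; the one generated by those noises
    gives adaptedness. *)
Lemma measurable_state t i : (t <= t0)%N -> measurable_fun [set: T] (fun w => X t w i 0).
Proof.
elim: t i => [|t IH] i tt0.
  by rewrite [X in measurable_fun _ X](_ : _ = fun=> X0 i 0)//; apply/funext => w; rewrite X_init.
rewrite [X in measurable_fun _ X](_ : _ = fun w => X t w i 0 - alpha t *
    \sum_(j < N) if e i j then f (h (X t w i 0) - h (X t w j 0) - n (t, i, j) w)
      else 0); last first.
  by apply/funext => w; rewrite X_step big_mkcond.
have mX j : measurable_fun [set: T] (fun w => X t w j 0) by apply: IH; exact: ltnW.
apply: measurable_funB => //; apply: measurable_funM => //; apply: measurable_sum => j.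
case: (boolP (e i j)) => // eij; apply: measurableT_comp => //.
apply: measurable_funB; last exact: mn.
by apply: measurable_funB; apply: measurableT_comp => //; exact: mX.
Qed.

Lemma measurable_energy t : (t <= t0)%N -> measurable_fun [set: T] (fun w => energy (X t w)).
Proof.
move=> tt0; apply: measurable_sum => i.
by apply: measurable_funX; exact: measurable_state.
Qed.

Lemma measurable_alive lam t : (t <= t0)%N -> measurable_fun [set: T] (alive X lam t).
Proof.
move=> tt0; apply: measurable_prod => s; rewrite mem_index_iota ltnS => /andP[_ st].
have -> : (fun w => (energy (X s w) <= lam)%R%:R : R) =
    (fun w => if energy (X s w) <= lam then 1 else 0).
  by apply/funext => w; case: leP.
apply: measurable_fun_ifT => //; apply: measurable_fun_ler => //.
by apply: measurable_energy; exact: leq_trans st tt0.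
Qed.

End state_measurability.

(** * The stopped supermartingale estimate and almost sure consensus *)

Section process.
Context {R : realType} {d : measure_display} {T : measurableType d} {P : probability T R}.
Context {N : nat} {e : rel 'I_N} {f h : R -> R} {n : nat * 'I_N * 'I_N -> {RV P >-> R}}.
Context {alpha : nat -> R} {X0 : 'cV[R]_N} {X : nat -> T -> 'cV[R]_N} {M : R}.
Hypotheses (e_sym : symmetric e) (f_incr : {homo f : x y / x < y}).
Hypotheses (f_odd : forall x, f (- x) = - f x) (fM : forall x, `|f x| <= M).
Hypothesis h_incr : {homo h : x y / x < y}.
Hypothesis n_indep : mutually_independent [set k | e k.1.2 k.2] n.
Hypothesis n_id : identically_distributed [set k | e k.1.2 k.2] n.
Hypothesis alpha_gt0 : forall t, 0 < alpha t.
Hypothesis X_init : forall w, X 0%N w = X0.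
Hypothesis X_step : forall (t : nat) (w : T) (i : 'I_N),
  X t.+1 w i 0 = X t w i 0 - alpha t *
    \sum_(j < N | e i j) f (h (X t w i 0) - h (X t w j 0) - n (t, i, j) w).
Variables (k0 : nat * 'I_N * 'I_N).
Hypotheses (ek0 : e k0.1.2 k0.2) (n_sym : symmetric_about_zero (n k0)).

Let F := smoothing (n k0) f.

Let mf : measurable_fun [set: R] f.
Proof. by apply: nondecreasing_measurable => //; exact: ltW_homo. Qed.

Let mh : measurable_fun [set: R] h.
Proof. by apply: nondecreasing_measurable => //; exact: ltW_homo. Qed.

Let mF : measurable_fun [set: R] F.
Proof. by apply: nondecreasing_measurable => //; exact: smoothing_nd fM. Qed.

Let M_ge0 : 0 <= M. Proof. by apply: le_trans (fM 0). Qed.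

Lemma interaction_bounded (y : 'I_N -> R) i :
  `|\sum_(j < N | e i j) f (y j)| <= N%:R * M.
Proof.
apply: le_trans (ler_norm_sum _ _ _) _.
apply: (@le_trans _ _ (\sum_(j < N) M)).
  by rewrite big_mkcond ler_sum// => j _; case: ifP.
by rewrite sumr_const card_ord mulr_natl.
Qed.

Lemma state_step_bounded t w i :
  `|X t.+1 w i 0 - X t w i 0| <= alpha t * (N%:R * M).
Proof.
rewrite X_step addrAC subrr add0r normrN normrM gtr0_norm// ler_pM2l//.
exact: interaction_bounded.
Qed.

Lemma state_bounded t i : exists B : R, forall w, `|X t w i 0| <= B.
Proof.
elim: t => [|t [B IH]]; first by exists `|X0 i 0| => w; rewrite X_init.
exists (B + alpha t * (N%:R * M)) => w.
rewrite -[X t.+1 w i 0](subrKC (X t w i 0)).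
by apply: le_trans (ler_normD _ _) _; rewrite lerD ?state_step_bounded.
Qed.

Let past t : set (nat * 'I_N * 'I_N) := [set k | e k.1.2 k.2 /\ (k.1.1 < t)%N].
Let hist t := cylinder (past t) n.

Lemma bounded_measurable_state t i : bounded_measurable (fun w : T => X t w i 0).
Proof.
split; last exact: state_bounded.
by apply: (measurable_state (n := fun k => n k) mf mh X_init X_step (t0 := t)).
Qed.

Lemma bounded_measurable_alive lam t : bounded_measurable (alive X lam t : T -> R).
Proof.
split; first by apply: (measurable_alive (n := fun k => n k) mf mh X_init X_step (t0 := t)).
by exists 1 => w; rewrite ger0_norm ?alive_le1// alive_ge0.
Qed.

Lemma bounded_measurable_interaction t i j : bounded_measurable
  (fun w : T => f (h (X t w i 0) - h (X t w j 0) - n (t, i, j) w)).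
Proof.
split; last by exists M => w.
have [mi _] := bounded_measurable_state t i.
have [mj _] := bounded_measurable_state t j.
apply: measurableT_comp => //; apply: measurable_funB => //.
by apply: measurable_funB; apply: measurableT_comp.
Qed.

Lemma bounded_measurable_smoothing t i j : bounded_measurable
  (fun w : T => F (h (X t w i 0) - h (X t w j 0))).
Proof.
split; last by exists M => w; exact: smoothing_bounded.
have [mi _] := bounded_measurable_state t i.
have [mj _] := bounded_measurable_state t j.
by apply: measurableT_comp => //; apply: measurable_funB; apply: measurableT_comp.
Qed.

(** [alive] and the state at time [t] are measurable for the noises strictly before [t], of which
    [n (t, i, j)] is independent. It can therefore be integrated out first, and its law is that of
    the reference noise [n k0] defining [F]. *)
Lemma noise_mean lam t i j : e i j ->
  \int[P]_w (alive X lam t w * X t w i 0 * f (h (X t w i 0) - h (X t w j 0) - n (t, i, j) w)) =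
  \int[P]_w (alive X lam t w * X t w i 0 * F (h (X t w i 0) - h (X t w j 0))).
Proof.
move=> eij.
pose G := g_sigma_algebraType (hist t).
have mn s k l : (s < t)%N -> e k l -> measurable_fun [set: G] (n (s, k, l) : T -> R).
  by move=> st ekl; apply: measurable_fun_cylinder.
have mX k : measurable_fun [set: G] (fun w : G => X t w k 0).
  exact: (measurable_state (n := fun k => n k) mf mh (T := G) X_init X_step mn).
have ma : measurable_fun [set: G] (alive X lam t : G -> R).
  exact: (measurable_alive (n := fun k => n k) mf mh (T := G) X_init X_step mn).
pose g (p : G * R) := alive X lam t p.1 * X t p.1 i 0 *
  f (h (X t p.1 i 0) - h (X t p.1 j 0) - p.2).
have bg : bounded_measurable g.
  apply: bounded_measurableM; first apply: bounded_measurableM.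
  - split; first exact: measurableT_comp ma _.
    by exists 1 => w; rewrite ger0_norm ?alive_le1// alive_ge0.
  - split; first exact: measurableT_comp (mX i) _.
    by have [B b] := state_bounded t i; exists B => w; exact: b.
  - split; last by exists M => w; exact: fM.
    apply: measurableT_comp => //; apply: measurable_funB => //.
    by apply: measurable_funB; apply: measurableT_comp => //;
      [exact: measurableT_comp (mX i) _|exact: measurableT_comp (mX j) _].
rewrite (@Rintegral_cylinder _ _ T P _ (past t) n _ (t, i, j) g n_indep) //.
- apply: eq_Rintegral => w _; rewrite /g /= RintegralZl//.
    congr (_ * _); congr fine; apply: eq_measure_integral => A mA _.
    exact: n_id.
  apply: bounded_measurable_integrable; split; last by exists M => y; exact: fM.
  by apply: measurableT_comp => //; exact: measurable_funB.
- by move=> k [].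
- by case=> _ /=; rewrite ltnn.
Qed.

Let D (x : 'cV[R]_N) := drift e h F (fun i => x i 0).

Let F_nd : {homo F : x y / x <= y}. Proof. exact: smoothing_nd fM. Qed.

Let F_odd y : F (- y) = - F y. Proof. exact: smoothing_odd fM _ _. Qed.

Let D_ge0 x : 0 <= D x. Proof. exact: drift_ge0. Qed.

Lemma drift_mean lam t :
  \int[P]_w (alive X lam t w * \sum_i \sum_(j < N | e i j)
     X t w i 0 * f (h (X t w i 0) - h (X t w j 0) - n (t, i, j) w)) =
  \int[P]_w (alive X lam t w * D (X t w)).
Proof.
have bx i j : bounded_measurable (fun w => alive X lam t w * X t w i 0 *
    f (h (X t w i 0) - h (X t w j 0) - n (t, i, j) w)).
  apply: bounded_measurableM.
    by apply: bounded_measurableM;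
      [exact: bounded_measurable_alive|exact: bounded_measurable_state].
  exact: bounded_measurable_interaction.
have bxF i j : bounded_measurable (fun w => alive X lam t w * X t w i 0 *
    F (h (X t w i 0) - h (X t w j 0))).
  apply: bounded_measurableM.
    by apply: bounded_measurableM;
      [exact: bounded_measurable_alive|exact: bounded_measurable_state].
  exact: bounded_measurable_smoothing.
under eq_Rintegral do rewrite mulr_sumr.
under [RHS]eq_Rintegral do rewrite mulr_sumr.
rewrite !Rintegral_sum; last 2 first.
- move=> i _; rewrite [X in bounded_measurable X](_ : _ = fun w => \sum_(j < N | e i j)
      alive X lam t w * X t w i 0 * F (h (X t w i 0) - h (X t w j 0))).
    by apply: bounded_measurable_sum => j _.
  by apply/funext => w; rewrite mulr_sumr; apply: eq_bigr => j _; rewrite mulrA.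
- move=> i _; rewrite [X in bounded_measurable X](_ : _ = fun w => \sum_(j < N | e i j)
      alive X lam t w * X t w i 0 * f (h (X t w i 0) - h (X t w j 0) - n (t, i, j) w)).
    by apply: bounded_measurable_sum => j _.
  by apply/funext => w; rewrite mulr_sumr; apply: eq_bigr => j _; rewrite mulrA.
apply: eq_bigr => i _.
transitivity (\sum_(j < N | e i j) \int[P]_w (alive X lam t w * X t w i 0 *
    f (h (X t w i 0) - h (X t w j 0) - n (t, i, j) w))).
  rewrite -Rintegral_sum//; apply: eq_Rintegral => w _.
  by rewrite mulr_sumr; apply: eq_bigr => j _; rewrite mulrA.
under eq_bigr => j eij do rewrite noise_mean//.
rewrite -Rintegral_sum//; apply: eq_Rintegral => w _.
by rewrite mulr_sumr; apply: eq_bigr => j _; rewrite mulrA.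
Qed.

Lemma bounded_measurable_energy t : bounded_measurable (fun w : T => energy (X t w)).
Proof.
apply: bounded_measurable_sum => i _.
rewrite [X in bounded_measurable X](_ : _ = fun w => X t w i 0 * X t w i 0).
  by apply: bounded_measurableM; exact: bounded_measurable_state.
by apply/funext => w; rewrite expr2.
Qed.

Lemma bounded_measurable_drift t : bounded_measurable (fun w : T => D (X t w)).
Proof.
apply: bounded_measurable_sum => i _; apply: bounded_measurable_sum => j _.
apply: bounded_measurableM; first exact: bounded_measurable_state.
exact: bounded_measurable_smoothing.
Qed.

(** Expand the square at each vertex: the quadratic term is at most [alpha t ^+ 2 * (N * M) ^+ 2],
    and there are [N] vertices. *)
Lemma energy_step t w : energy (X t.+1 w) <= energy (X t w)
  - 2 * alpha t * (\sum_i \sum_(j < N | e i j)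
      X t w i 0 * f (h (X t w i 0) - h (X t w j 0) - n (t, i, j) w))
  + N%:R * (N%:R * M) ^+ 2 * alpha t ^+ 2.
Proof.
have -> : N%:R * (N%:R * M) ^+ 2 * alpha t ^+ 2 =
    \sum_(i < N) (N%:R * M) ^+ 2 * alpha t ^+ 2.
  by rewrite sumr_const card_ord -mulrA mulr_natl.
rewrite mulr_sumr -sumrB -big_split/=; apply: ler_sum => i _.
rewrite X_step -mulr_sumr.
set S := \sum_(j < N | _) _.
have SNM : S ^+ 2 <= (N%:R * M) ^+ 2.
  rewrite -real_normK ?num_real// ler_pXn2r// ?nnegrE ?mulr_ge0//.
  exact: interaction_bounded.
have : 0 <= alpha t ^+ 2 by exact: sqr_ge0.
by nra.
Qed.

(* Adding [alive * energy] compensates this process into a supermartingale, up to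
   a summable term; while [excess < lam] forever, consensus is reached. *)
Definition excess lam t w : R := lam * (1 - alive X lam t w) +
  2 * \sum_(0 <= s < t) alpha s * (alive X lam s w * D (X s w)).

Lemma bounded_measurable_excess lam t : bounded_measurable (excess lam t).
Proof.
apply: bounded_measurableD.
  apply: bounded_measurableM; first exact: bounded_measurable_cst.
  apply: bounded_measurableB; first exact: bounded_measurable_cst.
  exact: bounded_measurable_alive.
apply: bounded_measurableM; first exact: bounded_measurable_cst.
apply: bounded_measurable_sum => s _.
apply: bounded_measurableM; first exact: bounded_measurable_cst.
apply: bounded_measurableM; first exact: bounded_measurable_alive.
exact: bounded_measurable_drift.
Qed.

Lemma measurable_excess_ge lam t : measurable [set w | lam <= excess lam t w].
Proof.
have [mx _] := bounded_measurable_excess lam t.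
rewrite [X in measurable X](_ : _ = excess lam t @^-1` `[lam, +oo[).
  by rewrite -[X in measurable X]setTI; exact: mx.
by apply/seteqP; split=> w /=; rewrite in_itv/= andbT.
Qed.

Lemma excess_nondecreasing lam w : 0 <= lam ->
  {homo (excess lam)^~ w : s t / (s <= t)%N >-> s <= t}.
Proof.
move=> lam_ge0; apply/nondecreasing_seqP => t; apply: lerD.
  by rewrite ler_wpM2l// lerD2l lerN2 alive_nonincreasing.
rewrite ler_pM2l// big_nat_recr//= lerDl.
by rewrite !mulr_ge0// ?alive_ge0// ltW.
Qed.

Lemma excess_ge0 lam t w : 0 <= lam -> 0 <= excess lam t w.
Proof.
move=> lam_ge0; rewrite addr_ge0// mulr_ge0// ?subr_ge0 ?alive_le1//.
by apply: sumr_ge0 => s _; rewrite !mulr_ge0// ?alive_ge0// ltW.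
Qed.

(** Once stopped, nothing moves. While the energy stays within [lam], this is [energy_step]. At the
    crossing, [excess] gains [lam] and [alive * energy] drops to 0, but [lam] is below the new
    energy, so [energy_step] still suffices. *)
Lemma excess_step lam t w : 0 <= lam ->
  excess lam t.+1 w + alive X lam t.+1 w * energy (X t.+1 w) <=
  excess lam t w + alive X lam t w * energy (X t w)
  + (2 * alpha t * (alive X lam t w * D (X t w))
  - 2 * alpha t * (alive X lam t w * \sum_i \sum_(j < N | e i j)
      X t w i 0 * f (h (X t w i 0) - h (X t w j 0) - n (t, i, j) w)))
  + N%:R * (N%:R * M) ^+ 2 * alpha t ^+ 2.
Proof.
move=> lam_ge0; have := energy_step t w.
set S := \sum_i _; set c := N%:R * _ * _; move=> estep.
rewrite /excess big_nat_recr//=; set G := \sum_(0 <= s < t) _.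
have c_ge0 : 0 <= c by rewrite /c mulr_ge0 ?sqr_ge0// mulr_ge0 ?sqr_ge0.
have E_ge0 : 0 <= energy (X t.+1 w) by apply: sumr_ge0 => i _; exact: sqr_ge0.
have := alive_01 X lam t w; rewrite aliveS; case=> ->.
  by rewrite !mul0r !subr0 !mulr0; lra.
rewrite !mul1r; case: (leP (energy (X t.+1 w)) lam) => El /=.
  by rewrite !mul1r; lra.
by rewrite !mul0r; lra.
Qed.

Lemma mean_excess lam t : 0 <= lam ->
  \int[P]_w (excess lam t w + alive X lam t w * energy (X t w)) <=
  energy X0 + N%:R * (N%:R * M) ^+ 2 * \sum_(0 <= s < t) alpha s ^+ 2.
Proof.
move=> lam_ge0.
have bae s : bounded_measurable (fun w => alive X lam s w * energy (X s w)).
  by apply: bounded_measurableM;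
    [exact: bounded_measurable_alive|exact: bounded_measurable_energy].
have bQ s : bounded_measurable
    (fun w => excess lam s w + alive X lam s w * energy (X s w)).
  by apply: bounded_measurableD; [exact: bounded_measurable_excess|].
elim: t => [|t IH].
  rewrite big_geq// mulr0 addr0.
  apply: (@le_trans _ _ (\int[P]_w energy X0)).
    apply: le_Rintegral => //; try by exact: bounded_measurable_integrable.
      by apply: bounded_measurable_integrable; exact: bounded_measurable_cst.
    (* If the process is stopped at time 0 already, the value is [lam], which is then below
       [energy X0]. *)
    move=> w _; rewrite /excess big_geq// mulr0 addr0 /alive big_nat1 X_init.
    by case: (leP (energy X0) lam) => /= El; lra.
  by rewrite Rintegral_cst// [X in fine X]probability_setT mulr1.
set c := N%:R * _.
have bD : bounded_measurable (fun w => 2 * alpha t * (alive X lam t w * D (X t w))).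
  apply: bounded_measurableM; first exact: bounded_measurable_cst.
  by apply: bounded_measurableM;
    [exact: bounded_measurable_alive|exact: bounded_measurable_drift].
pose S w := \sum_i \sum_(j < N | e i j)
  X t w i 0 * f (h (X t w i 0) - h (X t w j 0) - n (t, i, j) w).
have bS : bounded_measurable (fun w => alive X lam t w * S w).
  apply: bounded_measurableM; first exact: bounded_measurable_alive.
  apply: bounded_measurable_sum => i _; apply: bounded_measurable_sum => j _.
  by apply: bounded_measurableM;
    [exact: bounded_measurable_state|exact: bounded_measurable_interaction].
have baD : bounded_measurable (fun w => alive X lam t w * D (X t w)).
  by apply: bounded_measurableM;
    [exact: bounded_measurable_alive|exact: bounded_measurable_drift].
have bS2 : bounded_measurable (fun w => 2 * alpha t * (alive X lam t w * S w)).
  by apply: bounded_measurableM; first exact: bounded_measurable_cst.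
have bDS := bounded_measurableB bD bS2.
have bQDS := bounded_measurableD (bQ t) bDS.
have bc : bounded_measurable (fun _ : T => c * alpha t ^+ 2).
  exact: bounded_measurable_cst.
have bi := fun g (bg : @bounded_measurable R d T g) => bounded_measurable_integrable P bg.
apply: le_trans (le_Rintegral _ _ _ (fun w _ => excess_step t w lam_ge0)) _ => //.
- exact: bi (bQ t.+1).
- exact: bi (bounded_measurableD bQDS bc).
rewrite RintegralD//; [|exact: bi bQDS|exact: bi bc].
rewrite RintegralD//; [|exact: bi (bQ t)|exact: bi bDS].
rewrite RintegralB//; [|exact: bi bD|exact: bi bS2].
rewrite RintegralZl//; last exact: bi baD.
rewrite RintegralZl//; last exact: bi bS.
(* The drift added in [excess] and the noisy inner product cancel in mean; only the [alpha t ^+ 2]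
   term remains. *)
rewrite drift_mean subrr addr0 Rintegral_cst// [X in fine X]probability_setT mulr1.
by rewrite big_nat_recr//= mulrDr addrA lerD2r.
Qed.

(** Markov's inequality, with the nonnegative [alive * energy] added to reach the quantity bounded
    by [mean_excess]. *)
Lemma prob_excess lam t : 0 < lam ->
  (P [set w | (lam <= excess lam t w)%R] <=
   ((energy X0 + N%:R * (N%:R * M) ^+ 2 * \sum_(0 <= s < t) alpha s ^+ 2) / lam)%:E)%E.
Proof.
move=> lam_gt0; set A := mkset _.
have mA : measurable A by exact: measurable_excess_ge.
have b1 : bounded_measurable (\1_A : T -> R).
  split; first exact: measurable_indic.
  by exists 1 => w; rewrite indicE ger0_norm ?ler0n// lern1 leq_b1.
rewrite -[leLHS]fineK ?fin_num_measure// lee_fin ler_pdivlMr// mulrC.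
apply: le_trans (mean_excess t (ltW lam_gt0)).
have <- : \int[P]_w \1_A w = fine (P A) by rewrite /Rintegral integral_indic// setIT.
rewrite -RintegralZl//; last exact: bounded_measurable_integrable.
apply: le_Rintegral => //.
- apply: bounded_measurable_integrable; apply: bounded_measurableM => //.
  exact: bounded_measurable_cst.
- apply: bounded_measurable_integrable; apply: bounded_measurableD.
    exact: bounded_measurable_excess.
  by apply: bounded_measurableM;
    [exact: bounded_measurable_alive|exact: bounded_measurable_energy].
move=> w _; rewrite indicE.
have ae_ge0 : 0 <= alive X lam t w * energy (X t w).
  by rewrite mulr_ge0 ?alive_ge0// sumr_ge0// => i _; exact: sqr_ge0.
case: (boolP (w \in A)) => [|_]; last first.
  by rewrite mulr0 addr_ge0// excess_ge0// ltW.
by rewrite inE mulr1 /A /= => le; apply: le_trans le _; rewrite lerDl.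
Qed.

Lemma edge_consensus lam w i j :
  (forall L, exists t, L < \sum_(0 <= s < t) alpha s) ->
  alpha t @[t --> \oo] --> 0 ->
  0 < lam -> (forall t, excess lam t w < lam) -> e i j ->
  `|X t w i 0 - X t w j 0| @[t --> \oo] --> 0.
Proof.
move=> alpha_dvg alpha0 lam_gt0 exw eij.
have dr_ge0 t : 0 <= 2 * \sum_(0 <= s < t) alpha s * (alive X lam s w * D (X s w)).
  by rewrite mulr_ge0// sumr_ge0// => s _; rewrite !mulr_ge0// ?alive_ge0// ltW.
(* Being stopped would alone bring [excess] up to [lam]. *)
have a1 t : alive X lam t w = 1.
  have [a0|//] := alive_01 X lam t w.
  have := exw t; rewrite /excess a0 subr0 mulr1 ltNge => /negP; case.
  by rewrite lerDl.
(* Each end of the edge moves by at most [alpha t * (N * M)]; with [alive] equal to 1,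
   [excess < lam] says that the sums of [alpha * D] stay below [lam / 2]. *)
apply: (@cvg0_of_summable_drift R _ (fun t => D (X t w)) alpha (2 * (N%:R * M)) (lam / 2)) => //.
- move=> t; have := exw t; rewrite /excess a1 subrr mulr0 add0r.
  under eq_bigr do rewrite a1 mul1r.
  by lra.
- by rewrite !mulr_ge0.
- move=> t; have si := state_step_bounded t w i; have sj := state_step_bounded t w j.
  have -> : X t.+1 w i 0 - X t.+1 w j 0 = (X t w i 0 - X t w j 0) +
      ((X t.+1 w i 0 - X t w i 0) - (X t.+1 w j 0 - X t w j 0)) by lra.
  apply: le_trans (ler_normD _ _) _; rewrite lerD2l.
  by apply: le_trans (ler_normB _ _) _; lra.
move=> eps eps_gt0.
have F_gt0 := smoothing_gt0 f_incr f_odd fM n_sym.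
have [c c_gt0 cP] := drift_gap e_sym h_incr F_nd F_odd F_gt0 lam eps_gt0.
by exists c => // t xij; apply: cP eij _ xij; exact: alive1_energy (a1 t).
Qed.

Lemma process_consensus (L : R) (k : 'I_N) :
  (forall i j, connect e i j) ->
  (forall L', exists t, L' < \sum_(0 <= s < t) alpha s) ->
  (forall t, \sum_(0 <= s < t) alpha s ^+ 2 <= L) ->
  P [set w | \sum_i `|X t w i 0 - X t w k 0| @[t --> \oo] --> (0 : R)] = 1%E.
Proof.
move=> e_conn alpha_dvg alphaL; set E := mkset _.
have alpha0 : alpha t @[t --> \oo] --> (0 : R).
  apply: cvg0_of_sqr.
  exact: (cvg0_of_bounded_series (fun t => sqr_ge0 (alpha t)) alphaL).
have mE : measurable E.
  apply: measurable_cvg0 => t; apply: measurable_sum => i.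
  have [mi _] := bounded_measurable_state t i.
  have [mk _] := bounded_measurable_state t k.
  by apply: measurableT_comp => //; exact: measurable_funB.
rewrite -(setCK E) probability_setC; last exact: measurableC.
(* Bounds the numerator in [prob_excess] for all [t] and [lam] at once. *)
pose K := energy X0 + N%:R * (N%:R * M) ^+ 2 * L.
have c_ge0 : 0 <= N%:R * (N%:R * M) ^+ 2 by rewrite mulr_ge0 ?sqr_ge0.
have K_ge0 : 0 <= K.
  rewrite addr_ge0//; first by apply: sumr_ge0 => i _; exact: sqr_ge0.
  by rewrite mulr_ge0//; apply: le_trans (alphaL 0%N); rewrite big_geq.
rewrite (@probability0_of_le_div _ _ _ P _ K) ?sube0//; first exact: measurableC.
move=> lam lam_gt0.
pose A t := [set w | lam <= excess lam t w].
have mA t : measurable (A t) by exact: measurable_excess_ge.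
have mUA : measurable (\bigcup_t A t) by exact: bigcup_measurable.
have EA : ~` E `<=` \bigcup_t A t.
  move=> w nEw; apply: contrapT => nA; apply: nEw.
  have exw t : excess lam t w < lam.
    by rewrite ltNge; apply/negP => lex; apply: nA; exists t.
  have xw i : `|X t w i 0 - X t w k 0| @[t --> \oo] --> (0 : R).
    apply: (connected_consensus (e := e) (x := fun t => X t w)) => // l m elm.
    exact: edge_consensus exw elm.
  suff : \sum_i `|X t w i 0 - X t w k 0| @[t --> \oo] --> \sum_(i < N) (0 : R).
    by rewrite big1.
  apply: (@cvg_big R _ +%R 0 xpredT _ _ _ _ (fun i t => `|X t w i 0 - X t w k 0|)) => //.
  exact: add_continuous.
apply: (@le_trans _ _ (P (\bigcup_t A t))).
  by apply: le_measure => //; rewrite inE//; exact: measurableC.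
(* The events increase with [t] because [excess] does, so continuity from below carries the bound at
   fixed [t] over to the union. *)
have PA : P (A t) @[t --> \oo] --> P (\bigcup_t A t).
  apply: nondecreasing_cvg_mu => // s t st; apply/subsetPset => w /= lex.
  by apply: le_trans lex _; apply: excess_nondecreasing => //; exact: ltW.
rewrite -(cvg_lim _ PA)//; apply: lime_le; first by apply/cvg_ex; eexists; exact: PA.
apply: nearW => t; apply: le_trans (prob_excess t lam_gt0) _.
by rewrite lee_fin ler_pM2r ?invr_gt0// lerD2l ler_wpM2l.
Qed.

End process.

Theorem theorem2 (R : realType)
  (d : measure_display) (T : measurableType d) (P : probability T R)
  (N : nat) (N_gt0 : (0 < N)%N)
  (e : rel 'I_N) (e_sym : symmetric e) (e_irr : irreflexive e)
  (e_conn : forall i j : 'I_N, connect e i j)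
  (f h : R -> R)
  (f_incr : {homo f : x y / x < y}) (f_odd : forall x, f (- x) = - f x)
  (f_bnd : bounded_fun f)
  (h_incr : {homo h : x y / x < y})
  (n : nat * 'I_N * 'I_N -> {RV P >-> R})
  (n_indep : mutually_independent [set k | e k.1.2 k.2] n)
  (n_id : identically_distributed [set k | e k.1.2 k.2] n)
  (n_sym : forall (t : nat) (i j : 'I_N),
     e i j -> symmetric_about_zero (n (t, i, j)))
  (alpha : nat -> R) (alpha_gt0 : forall t, 0 < alpha t)
  (alpha_sum : (\sum_(0 <= t <oo) (alpha t)%:E = +oo)%E)
  (alpha_sum2 : (\sum_(0 <= t <oo) (alpha t ^+ 2)%:E < +oo)%E)
  (X0 : 'cV[R]_N) (X : nat -> T -> 'cV[R]_N)
  (X_init : forall w, X 0%N w = X0)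
  (X_step : forall (t : nat) (w : T) (i : 'I_N),
     X t.+1 w i 0 = X t w i 0 - alpha t *
       \sum_(j < N | e i j) f (h (X t w i 0) - h (X t w j 0) - n (t, i, j) w)) :
  P [set w | euclidean_dist (X t w) (@consensus_subspace R N) @[t --> \oo]
               --> (0 : R)] = 1%E.
Proof.
pose k : 'I_N := Ordinal N_gt0.
have -> : [set w | euclidean_dist (X t w) (@consensus_subspace R N) @[t --> \oo]
      --> (0 : R)] =
    [set w | \sum_i `|X t w i 0 - X t w k 0| @[t --> \oo] --> (0 : R)].
  apply/seteqP; split=> w; first exact: (cvg_euclidean_dist (fun t => X t w) k).1.
  exact: (cvg_euclidean_dist (fun t => X t w) k).2.
(* An edge supplies the reference noise that defines [F]. Without edges, connectedness leaves a
   single vertex and consensus is trivial. *)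
case: (pickP (fun p : 'I_N * 'I_N => e p.1 p.2)) => [[i0 j0] /= e00|no_edge].
  have [M [_ fM]] := f_bnd.
  (* [bounded_fun] yields the bound only for constants strictly above [M]. *)
  have {}fM x : `|f x| <= M + 1 by apply: fM; rewrite ?ltrDl.
  have [L alphaL] := nneseries_lty_bounded (fun t => sqr_ge0 (alpha t)) alpha_sum2.
  have alpha_dvg := nneseries_pinfty_unbounded (fun t => ltW (alpha_gt0 t)) alpha_sum.
  exact: (process_consensus (k0 := (0%N, i0, j0)) e_sym f_incr f_odd fM h_incr
    n_indep n_id alpha_gt0 X_init X_step e00 (n_sym 0%N i0 j0 e00) k e_conn
    alpha_dvg alphaL).
have one_vertex i : i = k.
  have /connectP[[|j p] /=] := e_conn i k; first by [].
  by rewrite (no_edge (i, j)).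
rewrite [X in P X](_ : _ = setT) ?probability_setT//.
apply/seteqP; split=> // w _ /=.
have -> : (fun t => \sum_i `|X t w i 0 - X t w k 0|) = fun=> 0.
  by apply/funext => t; rewrite big1// => i _; rewrite (one_vertex i) subrr normr0.
exact: cvg_cst.
Qed.
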